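(* (i) $(\mathcal{N},=)\models\forall\mathsf{x}\forall\mathsf{y}[\neg\neg(\mathsf{x}=\mathsf{y})\rightarrow\mathsf{x}=\mathsf{y}]$. (ii) $(\mathcal{N},\sim_V)\models\forall\mathsf{x}\,\neg\forall\mathsf{y}[\neg\neg(\mathsf{x}=\mathsf{y})\rightarrow\mathsf{x}=\mathsf{y}]$, i.e. for every $\gamma\in\mathcal{N}$ it is not the case that $\forall\alpha[\neg\neg(\gamma\sim_V\alpha)\rightarrow\gamma\sim_V\alpha]$.
   Context: Intuitionistic mathematics (constructive reading of logical constants; Markov's Principle not assumed), with Brouwer's Continuity Principle as an axiom (for every $R\subseteq\mathcal{N}\times\omega$, if $\forall\alpha\exists n[\alpha Rn]$ then $\forall\alpha\exists m\exists n\forall\beta[\overline{\alpha}m\sqsubset\beta\rightarrow\beta Rn]$, where $\overline{\alpha}m=\langle\alpha(0),\dots,\alpha(m-1)\rangle$ and $\sqsubset$ is ''initial segment of''). $\mathcal{N}=\omega^\omega$. The Vitali equivalence relation: $\alpha\sim_V\beta$ iff $\exists n\forall m>n[\alpha(m)=\beta(m)]$. In $(\mathcal{N},E)$ the symbol $=$ is interpreted by the relation $E$; satisfaction read intuitionistically. *)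

(* Defs.v *)
From Stdlib Require Import Arith.

Definition baire := nat -> nat.

Definition baire_eq (a b : baire) : Prop := forall n, a n = b n.

Definition vitali (a b : baire) : Prop := exists n, forall m, n < m -> a m = b m.

Definition init_seg (a : baire) (m : nat) (b : baire) : Prop :=
  forall i, i < m -> a i = b i.

Definition BCP : Prop :=
  forall R : baire -> nat -> Prop,
    (forall a, exists n, R a n) ->
    forall a, exists m n, forall b, init_seg a m b -> R b n.

(* (N,E) |= forall x forall y [~~(x = y) -> x = y], satisfaction read intuitionistically *)
Definition stable_eq (E : baire -> baire -> Prop) : Prop :=
  forall x y, ~ ~ E x y -> E x y.

(* Main.v *)
(** For (ii), fix [g] and perturb it along any [a] by adding 1 at the first
    place where [a] is nonzero.  The perturbation is not-not Vitali-equivalent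
    to [g]: if [a] has a nonzero value it changes [g] at one place only, and
    otherwise not at all.  Stability would therefore give, for every [a], a
    place [n] beyond which the perturbation agrees with [g]; by continuity [n]
    is determined by a finite initial segment of [a = 0], and a sequence that
    shares this segment but becomes nonzero after it and after [n] refutes it. *)

Require Import Defs.
From Stdlib Require Import Arith Lia Bool List.

Lemma baire_eq_stable : stable_eq baire_eq.
Proof.
  intros x y Hnn n.
  destruct (Nat.eq_dec (x n) (y n)) as [E | E]; [exact E |].
  exfalso. apply Hnn. intro H. apply E, H.
Qed.

Definition zero_below (a : baire) (m : nat) : bool :=
  forallb (fun i => a i =? 0) (seq 0 m).

Lemma zero_belowP (a : baire) (m : nat) :
  reflect (forall i, i < m -> a i = 0) (zero_below a m).
Proof.
  apply iff_reflect. unfold zero_below. rewrite forallb_forall.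
  split; intros H i Hi.
  - apply in_seq in Hi. apply Nat.eqb_eq, H. lia.
  - apply Nat.eqb_eq, H, in_seq. lia.
Qed.

Definition first_nonzero (a : baire) (m : nat) : bool :=
  zero_below a m && negb (a m =? 0).

Definition bump (g a : baire) : baire :=
  fun m => g m + (if first_nonzero a m then 1 else 0).

Lemma bump_after_nonzero (g a : baire) (k m : nat) :
  a k <> 0 -> k < m -> bump g a m = g m.
Proof.
  intros Hk Hkm. unfold bump, first_nonzero.
  destruct (zero_belowP a m) as [Hz | _]; simpl; [| lia].
  exfalso. apply Hk, Hz, Hkm.
Qed.

Lemma bump_of_zero (g a : baire) :
  (forall k, a k = 0) -> baire_eq (bump g a) g.
Proof.
  intros Hz m. unfold bump, first_nonzero. rewrite Hz. simpl.
  rewrite andb_false_r. lia.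
Qed.

Lemma bump_at_first_nonzero (g a : baire) (m : nat) :
  (forall i, i < m -> a i = 0) -> a m <> 0 -> bump g a m = S (g m).
Proof.
  intros Hz Hm. unfold bump, first_nonzero.
  destruct (zero_belowP a m) as [_ | Hnz]; [| contradiction].
  apply Nat.eqb_neq in Hm. rewrite Hm. simpl. lia.
Qed.

Lemma notnot_vitali_bump (g a : baire) : ~ ~ vitali g (bump g a).
Proof.
  intros Hnot.
  assert (Hz : forall k, a k = 0).
  { intro k. destruct (Nat.eq_dec (a k) 0) as [E | E]; [exact E |].
    exfalso. apply Hnot. exists k. intros m Hm.
    symmetry. exact (bump_after_nonzero g a k m E Hm). }
  apply Hnot. exists 0. intros m _. symmetry. apply (bump_of_zero g a Hz).
Qed.

Lemma BCP_not_all_vitali_bump (g : baire) :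
  BCP -> ~ (forall a, vitali g (bump g a)).
Proof.
  intros bcp Hall.
  destruct (bcp (fun a n => forall m, n < m -> g m = bump g a m)
                Hall (fun _ => 0)) as [m0 [n Hmod]].
  set (K := m0 + n + 1).
  set (b := fun i => if i =? K then 1 else 0).
  assert (Hb_zero : forall i, i < K -> b i = 0).
  { intros i Hi. unfold b. destruct (Nat.eqb_spec i K); [lia | reflexivity]. }
  assert (Hb_K : b K <> 0) by (unfold b; rewrite Nat.eqb_refl; discriminate).
  assert (Hseg : init_seg (fun _ => 0) m0 b).
  { intros i Hi. symmetry. apply Hb_zero. unfold K. lia. }
  specialize (Hmod b Hseg K ltac:(unfold K; lia)).
  rewrite (bump_at_first_nonzero g b K Hb_zero Hb_K) in Hmod. lia.
Qed.

Theorem theorem9p2 :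
  BCP ->
  stable_eq baire_eq /\
  (forall g : baire, ~ (forall a : baire, ~ ~ vitali g a -> vitali g a)).
Proof.
  intros bcp. split.
  - exact baire_eq_stable.
  - intros g Hstable.
    apply (BCP_not_all_vitali_bump g bcp).
    intro a. apply Hstable, notnot_vitali_bump.
Qed.
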